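(* Let $(X,\mathcal S,U,f)$ be a non-trivial splitting structure on a complete metric space $X$. Then for any $\epsilon_0>0$ and any countable collection $\{K_i\}_{i\in\mathbb N}$ of $\epsilon_0$-Cantor-winning subsets of $X$, the intersection $\bigcap_{i=1}^\infty K_i$ is $\epsilon_0$-Cantor-winning.
   Context: Let $(X,\mathbf d)$ be a metric space and $\mathcal B(X)$ the set of closed balls, each with centre $\mathrm{cent}(B)$ and radius $\mathrm{rad}(B)$. A splitting structure on $X$ is a quadruple $(X,\mathcal S,U,f)$ where: $U\subset\mathbb N$ is an infinite multiplicatively closed set such that $u,v\in U$, $u\mid v$ imply $v/u\in U$; $f:U\to\mathbb N$ is completely multiplicative; $\mathcal S$ assigns to each $B\in\mathcal B(X)$, $u\in U$ a collection $\mathcal S(B,u)$ of closed balls contained in $B$ of radius $\mathrm{rad}(B)/u$ with (S1) $\#\mathcal S(B,u)=f(u)$; (S2) distinct $b_1,b_2\in\mathcal S(B,u)$ satisfy $\mathbf d(\mathrm{cent}(b_1),\mathrm{cent}(b_2))\ge 2\mathrm{rad}(B)/u$; (S3) $\mathcal S(B,uv)=\bigcup_{b\in\mathcal S(B,u)}\mathcal S(b,v)$. It is non-trivial if $f\not\equiv1$. Generalised Cantor sets: given $B$, $R\in U$ and reals $\mathbf r=(r_{m,n})_{0\le m\le n}$, set $\mathcal B_0=\{B\}$; given $\mathcal B_n$, let $\mathcal I_{n+1}=\bigcup_{B_n\in\mathcal B_n}\mathcal S(B_n,R)$, $\mathcal I^{n+1}_{n+1}:=\mathcal I_{n+1}$,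 and for $k=0,\dots,n$ obtain $\mathcal I^{n-k}_{n+1}\subseteq\mathcal I^{n-k+1}_{n+1}$ by removing, for each $B_{n-k}\in\mathcal B_{n-k}$, at most $r_{n-k,n}$ balls from $\mathcal S(B_{n-k},R^{k+1})\cap\mathcal I^{n-k+1}_{n+1}$; put $\mathcal B_{n+1}:=\mathcal I^0_{n+1}$. Any resulting set $\bigcap_n\bigcup_{b\in\mathcal B_n}b$ is a $(B,R,\mathbf r)$-Cantor set. Cantor-winning: for $\epsilon_0>0$, $K\subseteq X$ is $\epsilon_0$-Cantor-winning on $B$ if for every $0<\epsilon<\epsilon_0$ there is $R_\epsilon\in U$ such that for every $R\in U$ with $R\ge R_\epsilon$, $K$ contains some $(B,R,\mathbf r)$-Cantor set with $r_{m,n}=f(R)^{(n-m+1)(1-\epsilon)}$ for all $0\le m\le n$; $K$ is $\epsilon_0$-Cantor-winning if it is $\epsilon_0$-Cantor-winning on every $B\in\mathcal B(X)$. *)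

(* Defs.v *)
From mathcomp Require Import all_boot all_order all_algebra.
From mathcomp Require Import all_classical all_reals all_analysis.
Set Implicit Arguments.
Unset Strict Implicit.
Unset Printing Implicit Defensive.
Import Order.TTheory GRing.Theory Num.Theory.
Import numFieldNormedType.Exports.
Local Open Scope classical_set_scope.
Local Open Scope ring_scope.

(* Stated by hand because the library's complete structures are pointed,
   whereas a metric space need not come with a base point. *)
Definition complete_metric (R : realType) (X : metricType R) : Prop :=
  forall u : nat -> X, cauchy (u @ \oo) -> exists x : X, u @ \oo --> x.

(* The points of a closed ball of a metric space determine neither its centre
   nor its radius, so a ball carries both as data. *)
Record cball (R : realType) (X : metricType R) := CBall {
  cent : X;
  rad : R;
  rad_gt0 : 0 < rad }.

(* Not the library's [closed_ball], which is the closure of the open ball. *)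
Definition points (R : realType) (X : metricType R) (B : cball X) : set X :=
  [set x | mdist (cent B) x <= rad B].

(* Here N = {1, 2, ...}; [splitf] and [splitS] are only constrained on
   [splitU]. *)
Record splitting_structure (R : realType) (X : metricType R) :=
  SplittingStructure {
  splitS : cball X -> nat -> set (cball X);
  splitU : set nat;
  splitf : nat -> nat;
  splitU_gt0 : forall u, splitU u -> (0 < u)%N;
  splitU_infinite : infinite_set splitU;
  splitU_mul : forall u v, splitU u -> splitU v -> splitU (u * v)%N;
  splitU_div : forall u v, splitU u -> splitU v -> (u %| v)%N ->
    splitU (v %/ u)%N;
  splitf_gt0 : forall u, splitU u -> (0 < splitf u)%N;
  splitf_mul : forall u v, splitU u -> splitU v ->
    splitf (u * v)%N = (splitf u * splitf v)%N;
  split_sub : forall B u, splitU u -> forall b, splitS B u b ->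
    points b `<=` points B;
  split_rad : forall B u, splitU u -> forall b, splitS B u b ->
    rad b = rad B / u%:R;
  split_card : forall B u, splitU u -> (splitS B u #= `I_(splitf u))%card;
  split_sep : forall B u, splitU u -> forall b1 b2,
    splitS B u b1 -> splitS B u b2 -> b1 <> b2 ->
    2 * rad B / u%:R <= mdist (cent b1) (cent b2);
  split_comp : forall B u v, splitU u -> splitU v ->
    splitS B (u * v)%N = \bigcup_(b in splitS B u) splitS b v }.

Section cantor_winning.
Context (R : realType) (X : metricType R) (ss : splitting_structure X).

Definition nontrivial_splitting : Prop :=
  exists2 u, splitU ss u & splitf ss u <> 1%N.

Definition at_most (T : Type) (A : set T) (r : R) : Prop :=
  exists2 k : nat, (A #= `I_k)%card & k%:R <= r.

(* [J] arises from [I] by removing, for each [b] in [Bm], at most [r] balls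
   (those in [D b]) from [splitS b q `&` I]. *)
Definition removal (Bm : set (cball X)) (q : nat) (r : R)
    (I J : set (cball X)) : Prop :=
  exists D : cball X -> set (cball X),
    (forall b, Bm b -> D b `<=` splitS ss b q `&` I /\ at_most (D b) r) /\
    J = I `\` \bigcup_(b in Bm) D b.

(* [I m] is the family with lower index n + 1 and upper index m; m plays the
   role of n - k, so that k + 1 is [(n - m).+1]. *)
Definition cantor_step (Rn : nat) (r : nat -> nat -> R)
    (BB : nat -> set (cball X)) (n : nat) : Prop :=
  exists I : nat -> set (cball X),
    [/\ I n.+1 = \bigcup_(b in BB n) splitS ss b Rn,
        (forall m, (m <= n)%N ->
          removal (BB m) (Rn ^ (n - m).+1)%N (r m n) (I m.+1) (I m))
      & BB n.+1 = I 0%N].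

Definition cantor_set (B : cball X) (Rn : nat) (r : nat -> nat -> R)
    (C : set X) : Prop :=
  exists BB : nat -> set (cball X),
    [/\ BB 0%N = [set B],
        (forall n, cantor_step Rn r BB n)
      & C = \bigcap_n \bigcup_(b in BB n) points b].

Definition cantor_winning_on (eps0 : R) (K : set X) (B : cball X) : Prop :=
  forall eps : R, 0 < eps -> eps < eps0 ->
  exists2 Reps : nat, splitU ss Reps &
    forall Rn : nat, splitU ss Rn -> (Reps <= Rn)%N ->
    exists2 C : set X,
      cantor_set B Rn
        (fun m n => (splitf ss Rn)%:R `^ ((n - m).+1%:R * (1 - eps))) C
      & C `<=` K.

Definition cantor_winning (eps0 : R) (K : set X) : Prop :=
  forall B : cball X, cantor_winning_on eps0 K B.

End cantor_winning.

(* Main.v *)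
(* Fix [B], [eps] and [R]. If [f R = 1] the one child of [B] may be removed, so
   the empty set is a Cantor set. If [f R >= 2], pick [eps < eps' < eps0] and
   exponents [k i] so large that [K i] contains a Cantor set on [B] for the base
   R^(k i) with parameter [eps']; since [f (R ^ k) = f R ^ k], this is a Cantor
   set for the base [R] whose removals respect the [eps'] bound. Letting
   [k i >= k0 + i + 1], at most [l] of these Cantor sets remove balls across a
   distance [l], and none do if [l < k0]. Performing all removals together costs
   at most [l * f R ^ (l (1 - eps')) <= f R ^ (l (1 - eps))] for [l >= k0] once
   [k0] is large. *)
Require Import Defs.
From mathcomp Require Import all_boot all_order all_algebra.
From mathcomp Require Import all_classical all_reals all_analysis.
From mathcomp Require Import zify lra.
Import Order.TTheory GRing.Theory Num.Theory.
Local Open Scope classical_set_scope.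
Local Open Scope ring_scope.

(** * Counting in finite sets *)

Lemma card_eq_II_enum {T : Type} {A : set T} {n : nat} :
  (A #= `I_n)%card ->
  exists2 g : 'I_n -> T, injective g & A = range g.
Proof.
move=> An; have /card_bijP[g [h gK hK]] : ([set: 'I_n] #= A)%card.
  by rewrite card_eq_sym; apply: card_eq_trans An card_II.
have inT (i : 'I_n) : i \in [set: 'I_n] by rewrite inE.
exists (fun i => val (g (SigSub (inT i)))).
  by move=> i j /val_inj /(can_inj gK) /(congr1 val).
apply/seteqP; split=> [x /mem_set Ax|_ [i _ <-]]; last exact/set_mem/valP.
exists (val (h (SigSub Ax))) => //.
rewrite (_ : SigSub _ = h (SigSub Ax)) ?hK //; exact: val_inj.
Qed.

Lemma sub_range_card {T : Type} {I : finType} {A : set T} (g : I -> T) :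
  A `<=` range g -> exists2 k : nat, (A #= `I_k)%card & (k <= #|I|)%N.
Proof.
move=> Ag; have An : (A #<= `I_#|I|)%card.
  apply: card_le_trans (_ : A #<= range (g \o enum_val (A := predT)))%card _.
    apply: subset_card_le => x /Ag[i _ <-]; exists (enum_rank i) => //=.
    by rewrite enum_rankK.
  apply: card_le_trans (card_image_le _ _) _.
  by rewrite (card_le_eqr card_II).
have /finite_setP[k Ak] : finite_set A by apply/finite_set_leP; exists #|I|.
by exists k => //; rewrite -card_le_II -(card_le_eql Ak).
Qed.

(* The union has a d elements, so the a d labels (i, x) with [x] in [F i] must
   be sent to it injectively. *)
Lemma card_bigcup_disjoint {I T : Type} {A : set I} {F : I -> set T}
    {a d : nat} :
  (A #= `I_a)%card -> (forall i, A i -> F i #= `I_d)%card ->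
  (\bigcup_(i in A) F i #= `I_(a * d))%card ->
  forall i j x, A i -> A j -> F i x -> F j x -> i = j.
Proof.
move=> /card_eq_II_enum[g ginj Ag] Fd /card_eq_II_enum[e einj Fe].
have Agi i : A (g i) by rewrite Ag; exists i.
have /choice[h hP] i : exists h : 'I_d -> T, F (g i) = range h.
  by have [h _ ->] := card_eq_II_enum (Fd _ (Agi i)); exists h.
(* [s] picks a label for each element of the union; it is injective between finite types of equal
   size, hence bijective. *)
have /choice[s sP] k : exists p : 'I_a * 'I_d, h p.1 p.2 = e k.
  have : (\bigcup_(i in A) F i) (e k) by rewrite Fe; exists k.
  case=> i; rewrite Ag => -[u _ <-]; rewrite hP => -[v _ huv].
  by exists (u, v).
have sinj : injective s by move=> k l skl; apply: einj; rewrite -!sP skl.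
have [|t _ tK] := inj_card_bij sinj; first by rewrite card_prod !card_ord.
move=> i' j' x; rewrite Ag => -[i _ <-] [j _ <-].
rewrite !hP => -[u _ <-] [v _ hvu]; congr g.
suff /(congr1 fst) : (i, u) = (j, v) by [].
rewrite -(tK (i, u)) -(tK (j, v)); congr s; apply: einj.
by rewrite -!sP !tK.
Qed.

Section at_most.
Context {R : realType} {T : Type}.
Implicit Types (A B : set T) (r : R).

Lemma at_most0 r : 0 <= r -> at_most (@set0 T) r.
Proof. by move=> r0; exists 0%N => //; rewrite II0. Qed.

Lemma at_most_sub A B r : A `<=` B -> at_most B r -> at_most A r.
Proof.
move=> AB [k /card_eq_II_enum[g _ Bg] kr]; rewrite Bg in AB.
have [l Al lk] := sub_range_card _ AB; exists l => //.
by rewrite (le_trans _ kr)// ler_nat -[k]card_ord.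
Qed.

(** Pairs of an index and a position in the enumeration of its set cover the union, and there are at
    most [N * r] of them. *)
Lemma at_most_bigcup (N : nat) (F : nat -> set T) r :
  (forall i, (i < N)%N -> at_most (F i) r) ->
  at_most (\bigcup_(i in `I_N) F i) (N%:R * r).
Proof.
move=> FN; have /choice[kg kgP] (i : 'I_N) :
    exists kg : {k : nat & 'I_k -> T}, F i = range (tagged kg) /\ (tag kg)%:R <= r.
  have [k /card_eq_II_enum[g _ Fg] kr] := FN _ (ltn_ord i).
  by exists (Tagged (fun k => 'I_k -> T) g).
pose k i := tag (kg i).
have [|l Fl lk] := @sub_range_card _ {i : 'I_N & 'I_(k i)}
    (\bigcup_(i in `I_N) F i) (fun p => tagged (kg (tag p)) (tagged p)).
  move=> x [i iN]; have [/= -> _] := kgP (Ordinal iN) => -[j _ <-].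
  by exists (Tagged (fun i => 'I_(k i)) j).
exists l => //; rewrite (le_trans (_ : _ <= (\sum_(i < N) k i)%N%:R))//.
  rewrite ler_nat (leq_trans lk)// card_tagged sumnE big_map big_enum /=.
  by apply: leq_sum => i _; rewrite card_ord.
rewrite natr_sum mulr_natl -[N in _ *+ N]card_ord -sumr_const.
by apply: ler_sum => i _; have [] := kgP i.
Qed.

End at_most.

(** * Splitting structures and their Cantor sets *)

Section splitting.
Context {R : realType} {X : metricType R} (ss : splitting_structure X).
Implicit Types (B b c : cball X) (BB : nat -> set (cball X)).

Lemma splitU1 : splitU ss 1.
Proof.
have [u Uu] := infinite_setN0 (@splitU_infinite _ _ ss).
by have := splitU_div Uu Uu (dvdnn u); rewrite divnn (splitU_gt0 Uu).
Qed.

Lemma splitU_exp u n : splitU ss u -> splitU ss (u ^ n)%N.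
Proof.
by move=> Uu; elim: n => [|n IH]; [exact: splitU1|rewrite expnS; exact: splitU_mul].
Qed.

Lemma splitf1 : splitf ss 1 = 1%N.
Proof.
apply/eqP; rewrite -(eqn_pmul2l (splitf_gt0 splitU1)) muln1.
by rewrite -(splitf_mul splitU1 splitU1).
Qed.

Lemma splitf_exp u n : splitU ss u -> splitf ss (u ^ n)%N = (splitf ss u ^ n)%N.
Proof.
move=> Uu; elim: n => [|n IH]; first exact: splitf1.
by rewrite !expnS splitf_mul ?IH//; exact: splitU_exp.
Qed.

(** By counting: [split_card], [split_comp] and [splitf_mul] leave exactly as many grandchildren as
    pairs of a child and a position below it, so no grandchild has two parents. *)
Lemma split_parent_unique B u v b1 b2 c : splitU ss u -> splitU ss v ->
  splitS ss B u b1 -> splitS ss B u b2 -> splitS ss b1 v c ->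
  splitS ss b2 v c -> b1 = b2.
Proof.
move=> Uu Uv Sb1 Sb2 Sc1 Sc2.
apply: (@card_bigcup_disjoint _ _ _ (splitS ss ^~ v) _ _ (split_card B Uu)
  _ _ _ _ _ Sb1 Sb2 Sc1 Sc2) => [b _|]; first exact: split_card.
by rewrite -split_comp// -splitf_mul//; exact/split_card/splitU_mul.
Qed.

Lemma cantor_stepP Rn (r : nat -> nat -> R) BB n :
  cantor_step ss Rn r BB n <->
  exists D : nat -> cball X -> set (cball X),
    (forall m b, (m <= n)%N -> BB m b ->
      D m b `<=` splitS ss b (Rn ^ (n - m).+1)%N /\ at_most (D m b) (r m n)) /\
    BB n.+1 = (\bigcup_(b in BB n) splitS ss b Rn) `\`
      \bigcup_(m in `I_n.+1) \bigcup_(b in BB m) D m b.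
Proof.
split.
- move=> [I [In rI BI]].
  have /choice[D DP] m : exists D : cball X -> set (cball X), (m <= n)%N ->
     (forall b, BB m b -> D b `<=` splitS ss b (Rn ^ (n - m).+1)%N `&` I m.+1 /\
       at_most (D b) (r m n)) /\
     I m = I m.+1 `\` \bigcup_(b in BB m) D b.
    have [mn|] := boolP (m <= n)%N; last by exists (fun=> set0).
    by have [D] := rI m mn; exists D.
  exists D; split=> [m b mn /(proj1 (DP m mn) b)[Dsub Dr]|].
    by split=> // c /Dsub[].
  rewrite BI -In.
  (* Rounds run from upper index [n.+1] down to 0; [j] counts those already done. *)
  suff IE j : (j <= n.+1)%N -> I (n.+1 - j)%N = I n.+1 `\`
      \bigcup_(m in [set m | (n.+1 - j <= m < n.+1)%N]) \bigcup_(b in BB m) D m b.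
    rewrite -(subnn n.+1) IE//; congr (_ `\` _).
    by apply: eq_bigcupl; split=> m /=; rewrite subnn.
  elim: j => [_|j IH jn].
    rewrite subn0 (_ : [set m | _] = set0) ?bigcup_set0 ?setD0//.
    by apply/seteqP; split=> m //=; lia.
  have nj : (n.+1 - j)%N = (n.+1 - j.+1).+1 by lia.
  have [_ ->] := DP (n.+1 - j.+1)%N ltac:(lia).
  rewrite -nj IH ?(ltnW jn)// setDDl; congr (_ `\` _).
  apply/seteqP; split=> c.
    case=> [[m /= mj Dc]|Dc]; first by exists m => //=; lia.
    by exists (n.+1 - j.+1)%N => //=; lia.
  move=> [m /= mj Dc]; have [mE|mE] := eqVneq m (n.+1 - j.+1)%N.
    by right; rewrite -mE.
  by left; exists m => //=; lia.
- move=> [D [DP BE]].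
  exists (fun j => (\bigcup_(b in BB n) splitS ss b Rn) `\`
    \bigcup_(m in [set m | (j <= m < n.+1)%N]) \bigcup_(b in BB m) D m b).
  split.
  + rewrite (_ : [set m | _] = set0) ?bigcup_set0 ?setD0//.
    by apply/seteqP; split=> m //=; lia.
  (* Cutting [D m b] down to the balls still present makes it admissible in [removal]. *)
  + move=> m mn; eexists (fun b => D m b `&` _); split=> [b bm|].
      have [Dsub Dr] := DP m b mn bm; split=> [c [/Dsub Sc Ic]|].
        by split; [exact: Sc|exact: Ic].
      by apply: at_most_sub Dr => c [].
    apply/seteqP; split=> c.
      move=> [Ic nDc]; split.
        split=> // -[m' /= m'P Dc]; apply: nDc; exists m' => //=; lia.
      move=> [b bm [Dc _]]; apply: nDc.
      by exists m; [rewrite /= leqnn|exists b].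
    move=> [[Ic nDc] nDm]; split=> // -[m' /= m'P [b bm Dc]].
    have [mE|mE] := eqVneq m' m; last first.
      by apply: nDc; exists m' => /=; [lia|exists b].
    apply: nDm; rewrite mE in bm Dc; exists b => //; split=> //.
  + rewrite BE; congr (_ `\` _).
Qed.

(** Iterating [split_comp] merges successive splittings into one. *)
Lemma descendant_split Rn BB m j : splitU ss Rn ->
  (forall n, BB n.+1 `<=` \bigcup_(b in BB n) splitS ss b Rn) ->
  \bigcup_(b in BB (m + j)%N) splitS ss b Rn `<=`
  \bigcup_(b in BB m) splitS ss b (Rn ^ j.+1)%N.
Proof.
move=> URn BBS; elim: j => [|j IH] c [b Bb Sc].
  by exists b; rewrite ?expn1// -[m]addn0.
rewrite addnS in Bb; have [b' Bb' Sb] := IH _ (BBS _ _ Bb); exists b' => //.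
rewrite expnSr split_comp//; last exact: splitU_exp.
by exists b.
Qed.

Lemma level_split Rn BB B n : splitU ss Rn -> BB 0%N = [set B] ->
  (forall n, BB n.+1 `<=` \bigcup_(b in BB n) splitS ss b Rn) ->
  BB n.+1 `<=` splitS ss B (Rn ^ n.+1)%N.
Proof.
move=> URn BB0 BBS c /BBS; rewrite -[n in BB n]add0n.
by move=> /(descendant_split _ _ _ _ URn BBS)[b]; rewrite BB0 => ->.
Qed.

(* A Cantor set for the base R^(k i) is one for the base R whose removals take
   place only between levels divisible by [k i]. A pair of levels at distance
   [l] thus receives removals only from the indices [i < k i <= l]. *)
Lemma cantor_set_bigcap B Rn (k : nat -> nat) (s : nat -> nat -> nat -> R)
    (r : nat -> nat -> R) (C : nat -> set X) :
  splitU ss Rn -> (forall i, i < k i)%N -> (forall m n, 0 <= r m n) ->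
  (forall i m n, (m <= n)%N ->
    (k i * (n - m).+1)%:R * s i m n <= r (k i * m)%N (k i * n.+1).-1) ->
  (forall i, cantor_set ss B (Rn ^ k i)%N (s i) (C i)) ->
  exists2 D, cantor_set ss B Rn r D & D `<=` \bigcap_i C i.
Proof.
move=> URn ik r0 sr /choice[P PP].
have Uk i : splitU ss (Rn ^ k i)%N by exact: splitU_exp.
have P0 i : P i 0%N = [set B] by have [] := PP i.
have /choice[D DP] (p : nat * nat) :
    exists D, (forall m b, (m <= p.2)%N -> P p.1 m b ->
      D m b `<=` splitS ss b ((Rn ^ k p.1) ^ (p.2 - m).+1)%N /\
      at_most (D m b) (s p.1 m p.2)) /\
    P p.1 p.2.+1 = (\bigcup_(b in P p.1 p.2) splitS ss b (Rn ^ k p.1)%N) `\`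
      \bigcup_(m in `I_p.2.+1) \bigcup_(b in P p.1 m) D m b.
  by have [_ /(_ p.2)/cantor_stepP] := PP p.1.
have PS i n : P i n.+1 `<=` \bigcup_(b in P i n) splitS ss b (Rn ^ k i)%N.
  by have [_ /= -> c []] := DP (i, n).
(* Removals of the [i]-th Cantor set, its levels [m'] and [n'.+1] rescaled by [k i]. *)
pose Ei i m n b := [set c | exists m' n', [/\ m = (k i * m')%N,
  n.+1 = (k i * n'.+1)%N, (m' <= n')%N, P i m' b & D (i, n') m' b c]].
pose E m n b := \bigcup_i Ei i m n b.
(* [Q] subtracts [E m n' b] for every ball [b], in [Q m] or not, which eases the comparison with
   each [P i]; [EQ] shows that only balls of [Q m] contribute. *)
pose Q := fix Q n := if n is n'.+1 then
  (\bigcup_(b in Q n') splitS ss b Rn) `\`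
    \bigcup_(m in `I_n'.+1) \bigcup_b E m n' b
  else [set B].
have QS n : Q n.+1 `<=` \bigcup_(b in Q n) splitS ss b Rn by move=> c [].
have lenE i m n m' n' : m = (k i * m')%N -> n.+1 = (k i * n'.+1)%N ->
    (m' <= n')%N -> (n - m).+1 = (k i * (n' - m').+1)%N.
  move=> mE nE mn; have k0 := leq_ltn_trans (leq0n i) (ik i).
  have le_mn : (m <= n)%N by rewrite -ltnS nE mE ltn_mul2l k0 ltnS.
  by rewrite -(subSn le_mn) -(subSn mn) mulnBr -nE -mE.
have ES m n b : E m n b `<=` splitS ss b (Rn ^ (n - m).+1)%N.
  move=> c [i _ [m' [n' [mE nE mn Pb Dc]]]].
  rewrite (lenE _ _ _ _ _ mE nE mn) expnM.
  by have [/(_ m' b mn Pb)[/(_ c Dc)]] := DP (i, n').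
have EQ m n b c : (m <= n)%N -> (\bigcup_(b in Q n) splitS ss b Rn) c ->
    E m n b c -> Q m b.
  move=> mn Qc Ec; have Sc := ES _ _ _ _ Ec.
  rewrite -(subnKC mn) in Qc.
  have [b' Qb' Sc'] := descendant_split _ _ _ _ URn QS _ Qc.
  case: Ec => i _ [m' [n' [mE _ _ Pb _]]].
  (* Level 0 is [[set B]] in both families. Further down, [b] and [b'] descend from [B] at level [m]
     and share the descendant [c], so they coincide. *)
  case: m' mE Pb => [|m'] mE Pb.
    by rewrite muln0 in mE; rewrite P0 in Pb; rewrite mE Pb.
  suff -> : b = b' by [].
  have m0 : (0 < m)%N by rewrite mE muln_gt0 (leq_ltn_trans _ (ik i)).
  apply: (split_parent_unique B _ _ _ _ _ (splitU_exp _ m URn)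
    (splitU_exp _ (n - m).+1 URn) _ _ Sc Sc').
    by rewrite mE expnM; exact: (level_split _ _ _ _ (Uk i) (P0 i) (PS i)).
  by case: (m) m0 Qb' => // m1 _; exact: (level_split _ _ _ _ URn (erefl _) QS).
exists (\bigcap_n \bigcup_(b in Q n) points b).
  exists Q; split=> // n; apply/cantor_stepP; exists (fun m => E m n).
  split=> [m b mn Qb|]; last first.
    apply/seteqP; split=> c [Sc nE]; split=> // -[m mn [b Qb Ec]].
      by apply: nE; exists m => //; exists b.
    by apply: nE; exists m => //; exists b => //; exact: EQ Ec.
  split; first exact: ES.
  (* A removal by index [i] forces [k i] to divide [l], whence [i < k i <= l]. *)
  pose l := (n - m).+1; apply: (@at_most_sub _ _ _ (\bigcup_(i in `I_l) Ei i m n b)).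
    move=> c [i _ Eic]; exists i => //=.
    case: Eic => m' [n' [mE nE mn' _ _]]; rewrite /l (lenE _ _ _ _ _ mE nE mn').
    by rewrite (leq_trans (ik i))// leq_pmulr.
  have l0 : 0 < l%:R :> R by rewrite ltr0n.
  (* Each of the [l] indices gets an equal share [r m n / l]; [sr] bounds [l] times its removals. *)
  rewrite -[r m n](divfK (lt0r_neq0 l0)) mulrC.
  apply: at_most_bigcup => i _.
  have [[m' [n' [mE nE mn']]]|nEi] := pselect (exists m' n',
      [/\ m = (k i * m')%N, n.+1 = (k i * n'.+1)%N & (m' <= n')%N]); last first.
    rewrite (_ : Ei i m n b = set0); first exact/at_most0/divr_ge0.
    rewrite -subset0 => c [m' [n' [mE nE mn' _ _]]]; apply: nEi.
    by exists m', n'.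
  have k0 : (0 < k i)%N := leq_ltn_trans (leq0n i) (ik i).
  have [Pb|nPb] := pselect (P i m' b); last first.
    rewrite (_ : Ei i m n b = set0); first exact/at_most0/divr_ge0.
    rewrite -subset0 => c [m1 [n1 [mE1 _ _ Pb _]]]; apply: nPb.
    by move/eqP: mE1; rewrite mE eqn_pmul2l// => /eqP ->.
  have [/(_ m' b mn' Pb)[_ [d dD ds]] _] := DP (i, n').
  apply: (@at_most_sub _ _ _ (D (i, n') m' b)).
    move=> c [m1 [n1 []]]; rewrite mE nE => /eqP + /eqP.
    by rewrite !eqn_pmul2l// => /eqP <- /eqP[<-].
  exists d => //; rewrite ler_pdivlMr// (le_trans (ler_wpM2r _ ds))// mulrC.
  by rewrite /l (lenE _ _ _ _ _ mE nE mn') (le_trans (sr _ _ _ mn'))// -mE -nE.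
(* At levels divisible by [k i], [Q] has undergone all removals of [P i]. *)
have QP i n : Q (k i * n)%N `<=` P i n.
  have k0 : (0 < k i)%N := leq_ltn_trans (leq0n i) (ik i).
  elim: n => [|n IH] c; first by rewrite muln0 P0.
  have knE : (k i * n.+1 = (k i * n + (k i).-1).+1)%N.
    by rewrite mulnS -addnS prednK// addnC.
  rewrite knE => -[Qc nE]; have [_ /= ->] := DP (i, n); split.
    have [b /IH Pb] := descendant_split _ _ _ _ URn QS _ Qc.
    by rewrite prednK// => Sc; exists b.
  move=> [m /= mn [b Pb Dc]]; apply: nE; exists (k i * m)%N => /=.
    by rewrite -knE ltn_pmul2l.
  by exists b => //; exists i => //; exists m, n.
move=> x Qx i _; have [_ _ ->] := PP i; move=> n _.
by have [b /QP Pb bx] := Qx (k i * n)%N I; exists b.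
Qed.

(** The only removal takes place in the step from level 0; all later levels are empty. *)
Lemma cantor_set_empty B Rn (r : nat -> nat -> R) : splitU ss Rn ->
  splitf ss Rn = 1%N -> 1 <= r 0%N 0%N -> (forall m n, 0 <= r m n) ->
  cantor_set ss B Rn r set0.
Proof.
move=> URn f1 r1 r0.
pose Q n : set (cball X) := if n is 0%N then [set B] else set0.
exists Q; split=> // [n|]; last first.
  by apply/seteqP; split=> // x /(_ 1%N I)[].
apply/cantor_stepP; exists (fun m b => if n is 0%N then splitS ss b Rn else set0).
case: n => [|n]; split=> [m b|].
- rewrite leqn0 => /eqP -> _; rewrite expn1; split=> //.
  by exists 1%N => //; rewrite -f1; exact: split_card.
- apply/seteqP; split=> // c [[b Qb Sc]]; apply.
  by exists 0%N => //; exists b.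
- by move=> _ _; split=> //; exact: at_most0.
- by rewrite bigcup_set0 set0D.
Qed.

End splitting.

(** * Absorbing a linear factor, and the conclusion *)

Lemma natr_le_powR {R : realType} (a d : R) : 1 < a -> 0 < d ->
  exists k : nat, forall l : nat, (k <= l)%N -> l%:R <= a `^ (l%:R * d).
Proof.
move=> a1 d0; have x0 : 0 < d * ln a by rewrite mulr_gt0// ln_gt0.
set x := d * ln a in x0; pose k := (Num.truncn (4 / x ^+ 2)).+1.
have a0 : a != 0 by rewrite gt_eqF// (lt_trans _ a1).
exists k => l kl; rewrite /powR (negbTE a0) -mulrA -/x.
have lk : 4 / x ^+ 2 <= l%:R.
  by rewrite (le_trans (ltW (truncnS_gt _)))// ler_nat.
rewrite ler_pdivrMr ?exprn_gt0// in lk.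
(* With t = l x / 2, e^(2t) >= (1 + t)^2 >= t^2 = l (l x^2 / 4), which is at least l by the choice
   of [k]. *)
have -> : l%:R * x = 2%:R * (l%:R * x / 2) by lra.
rewrite expRM_natl; have := expR_ge1Dx (l%:R * x / 2); set y := expR _ => yl.
have l0 : 0 <= l%:R :> R by [].
have lx0 : 0 <= l%:R * x by rewrite mulr_ge0// ltW.
have : (l%:R * x / 2) ^+ 2 <= y ^+ 2 by rewrite ler_sqr ?nnegrE; lra.
apply: le_trans; have := ler_wpM2l l0 lk; rewrite !expr2; lra.
Qed.

Theorem theorem9 (R : realType) (X : metricType R)
    (X_complete : complete_metric X)
    (ss : splitting_structure X) (ss_nontrivial : nontrivial_splitting ss)
    (eps0 : R) (eps0_gt0 : 0 < eps0)
    (K : nat -> set X) (K_winning : forall i, cantor_winning ss eps0 (K i)) :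
  cantor_winning ss eps0 (\bigcap_i K i).
Proof.
(* The threshold 1 works because [Rn] itself is raised to large powers below. *)
move=> B eps eps_gt0 eps_lt; exists 1%N; first exact: splitU1.
move=> Rn URn _; have fge0 m n :
    0 <= (splitf ss Rn)%:R `^ ((n - m).+1%:R * (1 - eps)) :> R.
  exact: powR_ge0.
have [f1|f1] := eqVneq (splitf ss Rn) 1%N.
  by exists set0 => //; apply: cantor_set_empty => //; rewrite f1 powR1.
have f_gt1 : (1 < splitf ss Rn)%N by have := splitf_gt0 URn; lia.
have Rn_gt1 : (1 < Rn)%N.
  have := splitU_gt0 URn; case: (Rn) f1 => [|[|]]//; by rewrite splitf1.
pose eps' := (eps + eps0) / 2; pose d := eps' - eps.
have eps'_gt0 : 0 < eps' by rewrite /eps'; lra.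
have eps'_lt : eps' < eps0 by rewrite /eps'; lra.
have d_gt0 : 0 < d by rewrite /d /eps'; lra.
set a : R := (splitf ss Rn)%:R in fge0 *.
have a_gt1 : 1 < a by rewrite /a ltr1n.
have [k0 k0P] := natr_le_powR _ _ a_gt1 d_gt0.
have /choice[Reps RepsP] i : exists Reps : nat, forall Rn : nat,
    splitU ss Rn -> (Reps <= Rn)%N -> exists2 C : set X, cantor_set ss B Rn
      (fun m n => (splitf ss Rn)%:R `^ ((n - m).+1%:R * (1 - eps'))) C & C `<=` K i.
  by have [Reps _ RepsP] := K_winning i B eps' eps'_gt0 eps'_lt; exists Reps.
(* [k0] serves the growth estimate, [i.+1] gives [i < k i], and [Reps i] makes [Rn ^ k i] exceed the
   threshold of [K i]. *)
pose k i := (k0 + i.+1 + Reps i)%N.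
have /choice[C CP] i : exists C : set X, cantor_set ss B (Rn ^ k i)%N
    (fun m n => (splitf ss (Rn ^ k i))%:R `^ ((n - m).+1%:R * (1 - eps'))) C /\
    C `<=` K i.
  have [||C] := RepsP i (Rn ^ k i)%N; first exact: splitU_exp.
    exact: leq_trans (leq_addl _ _) (ltnW (ltn_expl _ Rn_gt1)).
  by exists C.
have [||D DP DC] := @cantor_set_bigcap _ _ ss B Rn k _ _ C URn _ fge0 _
    (fun i => proj1 (CP i)).
- by move=> i; rewrite /k; lia.
- move=> i m n mn /=; rewrite splitf_exp// natrX -powR_mulrn ?ler0n// -/a.
  have k_gt0 : (0 < k i)%N by rewrite /k; lia.
  (* Index [n] denotes the step into level [n.+1], hence the predecessor after rescaling. *)
  have -> : ((k i * n.+1).-1 - k i * m).+1 = (k i * (n - m).+1)%N.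
    rewrite -(subSn mn) mulnBr -subSn ?prednK// ?muln_gt0 ?k_gt0//.
    by rewrite -ltnS prednK ?muln_gt0 ?k_gt0// ltn_pmul2l// ltnS.
  rewrite -powRrM mulrA -natrM; set l := (k i * _)%N.
  (* The gap [d] between [eps'] and [eps] pays for the factor [l]. *)
  have -> : l%:R * (1 - eps) = l%:R * d + l%:R * (1 - eps') by rewrite /d; lra.
  rewrite powRD; last by rewrite (gt_eqF (lt_trans ltr01 a_gt1)) implybT.
  rewrite ler_wpM2r ?powR_ge0// k0P//.
  by apply: (@leq_trans (k i)); [rewrite /k -addnA leq_addr|rewrite leq_pmulr].
exists D => //; apply: subset_trans DC _ => x Cx i _.
by have [_] := CP i; apply; exact: Cx.
Qed.
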